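(* Let $\rho$ be a two-qubit state of the form $$\rho=\tfrac14\Big(\mathbb{I}\otimes\mathbb{I}+x_3\,\sigma_3\otimes\mathbb{I}+y_3\,\mathbb{I}\otimes\sigma_3+\sum_{i,j=1}^3T_{ij}\,\sigma_i\otimes\sigma_j\Big),$$ with $x_3,y_3,T_{ij}\in\mathbb{R}$, and suppose that $\rho$ is either a pure state or a Werner state $\rho_W(F)$ with $0\le F\le 1$. Then the minimal error rate of the key is $$\delta_{\min}(\rho)=\frac12\Big(1-\sqrt{2\,\mathcal{D}_{\mathrm g}(\rho)}\Big),$$ where $\mathcal{D}_{\mathrm g}(\rho)$ is the geometric discord of $\rho$.
   Context: $|\uparrow\rangle,|\downarrow\rangle$ is a fixed orthonormal basis of $\mathbb{C}^2$, $\mathbb{I}$ is the $2\times 2$ identity, and $\sigma_1=|\uparrow\rangle\langle\downarrow|+|\downarrow\rangle\langle\uparrow|$, $\sigma_2=-i|\uparrow\rangle\langle\downarrow|+i|\downarrow\rangle\langle\uparrow|$, $\sigma_3=|\uparrow\rangle\langle\uparrow|-|\downarrow\rangle\langle\downarrow|$ are the Pauli matrices. For a unit vector $\boldsymbol n\in\mathbb{R}^3$, $\sigma_{\boldsymbol n}=n_1\sigma_1+n_2\sigma_2+n_3\sigma_3$. A two-qubit state is a positive semidefinite, trace-one operator on $\mathbb{C}^2\otimes\mathbb{C}^2$; it is pure if it has rank one. Every two-qubit state has the form displayed in the claim in suitably chosen local bases, and this choice of bases is a standing convention. Werner states. With $|\Phi^\pm\rangle=(|\uparrow\uparrow\rangle\pm|\downarrow\downarrow\rangle)/\sqrt2$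 and $|\Psi^\pm\rangle=(|\uparrow\downarrow\rangle\pm|\downarrow\uparrow\rangle)/\sqrt2$, and writing $\Phi^\pm,\Psi^\pm$ for the corresponding rank-one projections, $\rho_W(F)=F\,\Phi^++\frac{1-F}{3}(\Phi^-+\Psi^++\Psi^-)$ for $0\le F\le1$. Error rate. Let $\boldsymbol x=(1,0,0)$ and $\boldsymbol y=(0,1,0)$. For unit vectors $\boldsymbol a,\boldsymbol b\in\mathbb{R}^3$ write $\langle\boldsymbol a\otimes\boldsymbol b\rangle=\mathrm{Tr}[\rho(\sigma_{\boldsymbol a}\otimes\sigma_{\boldsymbol b})]$. The probability that the outcomes ($\pm1$) of measuring $\sigma_{\boldsymbol a}$ on the first qubit and $\sigma_{\boldsymbol b}$ on the second qubit differ is $(1-\langle\boldsymbol a\otimes\boldsymbol b\rangle)/2$. The error rate of the key for settings $\boldsymbol b,\boldsymbol b'$ on the second qubit is the average of these probabilities for the joint measurements $\sigma_{\boldsymbol x}\otimes\sigma_{\boldsymbol b}$ and $\sigma_{\boldsymbol y}\otimes\sigma_{\boldsymbol b'}$, i.e. $\frac12-\frac14\big(\langle\boldsymbol x\otimes\boldsymbol b\rangle+\langle\boldsymbol y\otimes\boldsymbol b'\rangle\big)$, and $\delta_{\min}(\rho)$ is its minimum over all unit vectors $\boldsymbol b,\boldsymbol b'\in\mathbb{R}^3$. Geometric discord. For a projective measurement $\Pi^a=\{\Pi^a_1,\Pi^a_2\}$ on the first qubit (rank-one orthogonal projections on $\mathbb{C}^2$ with $\Pi^a_1+\Pi^a_2=\mathbb{I}$),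 put $\chi_\rho=\sum_i(\Pi^a_i\otimes\mathbb{I})\rho(\Pi^a_i\otimes\mathbb{I})$. With $\|A\|^2=\mathrm{Tr}(AA^\dagger)$, $\mathcal{D}_{\mathrm g}(\rho)=\min_{\Pi^a}\|\rho-\chi_\rho\|^2$. *)

(* Defs.v *)
From HB Require Import structures.
From mathcomp Require Import all_boot all_order all_algebra.
From mathcomp Require Import all_real_closed.
From mathcomp Require Import classical_sets reals.

Set Implicit Arguments.
Unset Strict Implicit.
Unset Printing Implicit Defensive.

Import Order.TTheory GRing.Theory Num.Theory.

Local Open Scope classical_set_scope.
Local Open Scope ring_scope.
Local Open Scope complex_scope.
Local Open Scope sesquilinear_scope.

(* Operators on C^2 (x) C^2 are matrices in 'M[R[i]]_(2 * 2), [_ *t _] being the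
   Kronecker product and [_ ^t*] the conjugate transpose. *)

Definition ket_up (R : realType) : 'cV[R[i]]_2 := delta_mx 0 0.
Definition ket_down (R : realType) : 'cV[R[i]]_2 := delta_mx 1 0.

Definition ketbra (R : realType) (n : nat) (u v : 'cV[R[i]]_n) : 'M[R[i]]_n :=
  u *m v ^t*.

Definition sigma1 (R : realType) : 'M[R[i]]_2 :=
  ketbra (ket_up R) (ket_down R) + ketbra (ket_down R) (ket_up R).
Definition sigma2 (R : realType) : 'M[R[i]]_2 :=
  - 'i%C *: ketbra (ket_up R) (ket_down R) + 'i%C *: ketbra (ket_down R) (ket_up R).
Definition sigma3 (R : realType) : 'M[R[i]]_2 :=
  ketbra (ket_up R) (ket_up R) - ketbra (ket_down R) (ket_down R).

(* Indices are shifted: [pauli R 0], [pauli R 1], [pauli R 2] are the matrices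
   sigma_1, sigma_2, sigma_3. *)
Definition pauli (R : realType) (i : 'I_3) : 'M[R[i]]_2 :=
  tnth [tuple sigma1 R; sigma2 R; sigma3 R] i.

Definition unit_vector (R : realType) : set 'rV[R]_3 :=
  [set n | \sum_i n 0 i ^+ 2 = 1].

Definition pauli_along (R : realType) (n : 'rV[R]_3) : 'M[R[i]]_2 :=
  \sum_i (n 0 i)%:C *: pauli R i.

Definition psd (R : realType) (n : nat) (A : 'M[R[i]]_n) : Prop :=
  A ^t* = A /\ forall v : 'cV[R[i]]_n, 0 <= (v ^t* *m A *m v) 0 0.

Definition two_qubit_state (R : realType) (rho : 'M[R[i]]_(2 * 2)) : Prop :=
  psd rho /\ \tr rho = 1.

Definition pure_state (R : realType) (rho : 'M[R[i]]_(2 * 2)) : Prop :=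
  two_qubit_state rho /\ \rank rho = 1%N.

Definition bloch_form (R : realType) (x3 y3 : R) (T : 'M[R]_3) :
    'M[R[i]]_(2 * 2) :=
  4^-1 *: (1%:M *t 1%:M
           + x3%:C *: (sigma3 R *t 1%:M)
           + y3%:C *: (1%:M *t sigma3 R)
           + \sum_i \sum_j (T i j)%:C *: (pauli R i *t pauli R j)).

Definition proj (R : realType) (n : nat) (v : 'cV[R[i]]_n) : 'M[R[i]]_n :=
  ketbra v v.

Definition ket_Phi_plus (R : realType) : 'cV[R[i]]_(2 * 2) :=
  ((Num.sqrt 2)^-1)%:C *: (ket_up R *t ket_up R + ket_down R *t ket_down R).
Definition ket_Phi_minus (R : realType) : 'cV[R[i]]_(2 * 2) :=
  ((Num.sqrt 2)^-1)%:C *: (ket_up R *t ket_up R - ket_down R *t ket_down R).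
Definition ket_Psi_plus (R : realType) : 'cV[R[i]]_(2 * 2) :=
  ((Num.sqrt 2)^-1)%:C *: (ket_up R *t ket_down R + ket_down R *t ket_up R).
Definition ket_Psi_minus (R : realType) : 'cV[R[i]]_(2 * 2) :=
  ((Num.sqrt 2)^-1)%:C *: (ket_up R *t ket_down R - ket_down R *t ket_up R).

Definition werner (R : realType) (F : R) : 'M[R[i]]_(2 * 2) :=
  F%:C *: proj (ket_Phi_plus R)
  + ((1 - F) / 3)%:C *: (proj (ket_Phi_minus R) + proj (ket_Psi_plus R)
                         + proj (ket_Psi_minus R)).

(* The trace is real when rho is Hermitian, so [complex.Re] only changes its
   type; the same holds in [normsq] below. *)
Definition correlation (R : realType) (rho : 'M[R[i]]_(2 * 2))
    (a b : 'rV[R]_3) : R :=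
  complex.Re (\tr (rho *m (pauli_along a *t pauli_along b))).

Definition outcomes_differ (R : realType) (rho : 'M[R[i]]_(2 * 2))
    (a b : 'rV[R]_3) : R :=
  (1 - correlation rho a b) / 2.

Definition error_rate (R : realType) (rho : 'M[R[i]]_(2 * 2))
    (b b' : 'rV[R]_3) : R :=
  (outcomes_differ rho (delta_mx 0 0) b
   + outcomes_differ rho (delta_mx 0 1) b') / 2.

Definition error_rates (R : realType) (rho : 'M[R[i]]_(2 * 2)) : set R :=
  [set error_rate rho b b' | b in @unit_vector R & b' in @unit_vector R].

(* An infimum; it is a minimum exactly when it belongs to [error_rates rho]. *)
Definition min_error_rate (R : realType) (rho : 'M[R[i]]_(2 * 2)) : R :=
  inf (error_rates rho).

(* Mutual orthogonality of the two projections follows from their sum being the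
   identity. *)
Definition projective_measurement (R : realType) (P : 'I_2 -> 'M[R[i]]_2) :
    Prop :=
  (forall i, [/\ P i ^t* = P i, P i *m P i = P i & \rank (P i) = 1%N])
  /\ \sum_i P i = 1%:M.

Definition post_measurement (R : realType) (P : 'I_2 -> 'M[R[i]]_2)
    (rho : 'M[R[i]]_(2 * 2)) : 'M[R[i]]_(2 * 2) :=
  \sum_i (P i *t 1%:M) *m rho *m (P i *t 1%:M).

Definition normsq (R : realType) (n : nat) (A : 'M[R[i]]_n) : R :=
  complex.Re (\tr (A *m A ^t*)).

Definition discord_values (R : realType) (rho : 'M[R[i]]_(2 * 2)) : set R :=
  [set normsq (rho - post_measurement P rho)
  | P in @projective_measurement R].

(* An infimum; it is a minimum exactly when it belongs to
   [discord_values rho]. *)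
Definition geometric_discord (R : realType) (rho : 'M[R[i]]_(2 * 2)) : R :=
  inf (discord_values rho).

(* Main.v *)
(** Write [x = x3 e_3].  If [T T^T] is diagonal with entries [s^2, s^2, t^2] and
    [s^2 <= t^2 + x3^2], then both quantities are explicit in [s >= 0].  The
    correlations are [<a (x) b> = a^T T b], so the optimal [b] and [b'] are
    parallel to the first two rows of [T], and the minimal error rate is
    [(1 - s) / 2].  Measuring the first qubit along [n] replaces every Bloch
    vector [u] by [(n . u) n], so the discord value at [n] is
    [(tr K - n^T K n) / 4] with
    [K = x x^T + T T^T = diag(s^2, s^2, t^2 + x3^2)]; it is least at
    [n = e_3], where it equals [s^2 / 2].

    A Werner state has [x = 0] and [T = diag(c, -c, c)] with
    [c = (4 F - 1) / 3].  A pure state is idempotent, and comparing Pauli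
    coefficients in [rho^2 = rho] gives [T T^T = x x^T - det T], so
    [s^2 = t^2 - x3^2 = - det T]. *)

Require Import Defs.
From mathcomp Require Import all_boot all_order all_algebra.
From mathcomp Require Import all_real_closed.
From mathcomp Require Import classical_sets reals.
From mathcomp Require Import ring lra.

Set Implicit Arguments.
Unset Strict Implicit.
Unset Printing Implicit Defensive.

Import Order.TTheory GRing.Theory Num.Theory.
Local Open Scope ring_scope.
Local Open Scope complex_scope.
Local Open Scope sesquilinear_scope.

(** * Rank-one matrices, small sums, attained infima and Kronecker products *)

Lemma mxtrace_tens (R : comPzRingType) m n (A : 'M[R]_m) (B : 'M[R]_n) :
  \tr (A *t B) = \tr A * \tr B.
Proof. by rewrite /mxtrace mulr_sum; apply: eq_bigr => i _; rewrite !mxE. Qed.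

(** A rank-one matrix is a column [u] times a row [v], so its square is [u (v u) v], and the scalar
    [v u] is its trace. *)
Lemma rank1_mulmx_sqr (F : fieldType) n (A : 'M[F]_n) :
  \rank A = 1%N -> A *m A = \tr A *: A.
Proof.
move=> rA; move: (col_base A) (row_base A) (mulmx_base A).
rewrite rA => u v <-.
rewrite mulmxA -(mulmxA u v u) [v *m u]mx11_scalar mul_mx_scalar -scalemxAl.
by rewrite mxtrace_mulC -trace_mx11.
Qed.

Lemma ord2_ind (P : 'I_2 -> Prop) : P 0 -> P 1 -> forall i, P i.
Proof.
by move=> P0 P1 [[|[|//]] le]; [move: P0|move: P1]; congr P; apply: val_inj.
Qed.

Lemma ord3_ind (P : 'I_3 -> Prop) : P 0 -> P 1 -> P 2%R -> forall i, P i.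
Proof.
by move=> P0 P1 P2 [[|[|[|//]]] le]; [move: P0|move: P1|move: P2];
  congr P; apply: val_inj.
Qed.

Lemma sum2E (V : nmodType) (f : 'I_2 -> V) : \sum_i f i = f 0 + f 1.
Proof.
rewrite !big_ord_recl big_ord0 addr0.
by congr (f _ + f _); apply: val_inj.
Qed.

Lemma sum3E (V : nmodType) (f : 'I_3 -> V) : \sum_i f i = f 0 + f 1 + f 2%R.
Proof.
rewrite !big_ord_recl big_ord0 addr0 addrA.
by congr (f _ + f _ + f _); apply: val_inj.
Qed.

Lemma inf_min (R : realType) (E : set R) (x : R) :
  E x -> lbound E x -> inf E = x.
Proof.
move=> Ex lbx; apply: le_anti; rewrite ge_inf //=; last by exists x.
by apply: lb_le_inf => //; exists x.
Qed.

Lemma tensmxDl (R : pzRingType) m n p q (A A' : 'M[R]_(m, n))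
    (B : 'M[R]_(p, q)) :
  (A + A') *t B = A *t B + A' *t B.
Proof. by apply/matrixP => i j; rewrite !mxE mulrDl. Qed.

Lemma tensmxZl (R : pzRingType) m n p q a (A : 'M[R]_(m, n))
    (B : 'M[R]_(p, q)) :
  (a *: A) *t B = a *: (A *t B).
Proof. by apply/matrixP => i j; rewrite !mxE mulrA. Qed.

Lemma tensmx_suml (R : pzRingType) m n p q I (r : seq I)
    (A : I -> 'M[R]_(m, n)) (B : 'M[R]_(p, q)) :
  (\sum_(i <- r) A i) *t B = \sum_(i <- r) A i *t B.
Proof.
apply/matrixP => i j; rewrite !(mxE, summxE) mulr_suml.
by apply: eq_bigr => k _; rewrite mxE.
Qed.

Lemma mxtens_sum (V : nmodType) m n (f : 'I_(m * n) -> V) :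
  \sum_i f i = \sum_i \sum_j f (mxtens_index (i, j)).
Proof.
rewrite pair_bigA (reindex (@mxtens_index m n)) /=; last first.
  exists (@mxtens_unindex m n) => ? _.
    exact: mxtens_indexK.
  exact: mxtens_unindexK.
by apply: eq_bigr => -[].
Qed.

Ltac complex_eq :=
  apply/eqP; rewrite eq_complex /=; apply/andP; split; apply/eqP.

(** * Algebra of the Pauli matrices *)

Section Pauli.
Variable R : realType.
Implicit Types (u v : 'rV[R]_3) (A B : 'M[R[i]]_2).

Definition dot u v : R := \sum_i u 0 i * v 0 i.

Lemma ketbra_delta n (i j : 'I_n) :
  ketbra (delta_mx i 0) (delta_mx j 0) = delta_mx i j :> 'M[R[i]]_n.
Proof. by rewrite /ketbra trmx_delta map_delta_mx mul_delta_mx. Qed.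

Lemma pauli_alongE (n : 'rV[R]_3) :
  [/\ pauli_along n 0 0 = (n 0 2%R)%:C, pauli_along n 0 1 = n 0 0 -i* n 0 1,
      pauli_along n 1 0 = n 0 0 +i* n 0 1 & pauli_along n 1 1 = (- n 0 2%R)%:C].
Proof.
rewrite /pauli_along sum3E /pauli /= /sigma1 /sigma2 /sigma3 /ket_up /ket_down.
rewrite !ketbra_delta.
by split; rewrite !mxE /=; complex_eq; ring.
Qed.

Lemma pauli_along_lincomb a b u v :
  pauli_along (a *: u + b *: v)
  = a%:C *: pauli_along u + b%:C *: pauli_along v.
Proof.
rewrite /pauli_along !scaler_sumr -big_split; apply: eq_bigr => i _ /=.
by rewrite !mxE rmorphD !rmorphM scalerDl !scalerA.
Qed.

Lemma pauli_delta i : pauli_along (delta_mx 0 i) = pauli R i.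
Proof.
rewrite /pauli_along (bigD1 i) //= big1 ?addr0 => [|j /negPf ji].
  by rewrite !mxE !eqxx scale1r.
by rewrite !mxE ji andbF scale0r.
Qed.

(** The Clifford relation; the trace formula for products and the action of a measurement on Bloch
    vectors both come from it. *)
Lemma pauli_along_anticomm u v :
  pauli_along u *m pauli_along v + pauli_along v *m pauli_along u
  = (2 * dot u v)%:C%:M.
Proof.
have [u00 u01 u10 u11] := pauli_alongE u.
have [v00 v01 v10 v11] := pauli_alongE v.
apply/matrixP; do 2!apply: ord2_ind; rewrite !mxE !sum2E /dot sum3E.
all: rewrite ?u00 ?u01 ?u10 ?u11 ?v00 ?v01 ?v10 ?v11 /= ?mulr1n ?mulr0n.
all: complex_eq; ring.
Qed.

Lemma mxtrace_pauli u : \tr (pauli_along u) = 0.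
Proof.
have [u00 _ _ u11] := pauli_alongE u.
by rewrite /mxtrace sum2E u00 u11 -rmorphD subrr.
Qed.

Lemma mxtrace_pauliM u v :
  \tr (pauli_along u *m pauli_along v) = (2 * dot u v)%:C.
Proof.
have := congr1 mxtrace (pauli_along_anticomm u v).
rewrite mxtraceD (mxtrace_mulC (pauli_along v)) mxtrace_scalar -!mulr2n.
by move/eqP; rewrite eqr_pMn2r // => /eqP.
Qed.

Lemma pauli_along_herm u : (pauli_along u) ^t* = pauli_along u.
Proof.
have [u00 u01 u10 u11] := pauli_alongE u.
apply/matrixP; do 2!apply: ord2_ind; rewrite !mxE ?u00 ?u01 ?u10 ?u11.
all: complex_eq; ring.
Qed.

(** * Hermitian matrices and projective measurements on one qubit *)

Lemma hermitian2_pauli A : A ^t* = A ->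
  exists n : 'rV[R]_3, A = 2^-1 *: ((\tr A)%:M + pauli_along n).
Proof.
move=> hA; have {hA} hA i j : A i j = (A j i)^*%C by rewrite -{1}hA !mxE.
(* The Bloch vector is read off the lower-left entry, which is [(n_1 + i n_2) / 2], and the
   difference of the diagonal entries, which is [n_3]. *)
pose s := [tuple 2 * complex.Re (A 1 0); 2 * complex.Im (A 1 0);
                 complex.Re (A 0 0) - complex.Re (A 1 1)].
pose n : 'rV[R]_3 := \row_i tnth s i.
exists n; have [n00 n01 n10 n11] := pauli_alongE n.
have h2 : (2^-1 : R[i]) = (2^-1)%:C by rewrite fmorphV rmorph_nat.
apply/matrixP; do 2!apply: ord2_ind;
  rewrite !mxE ?n00 ?n01 ?n10 ?n11 /mxtrace sum2E !mxE h2.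
all: move: (hA 0 0) (hA 1 1) (hA 0 1) => /=.
all: rewrite ?mulr1n ?mulr0n /s /tnth /=.
all: case: (A 0 0) (A 0 1) (A 1 0) (A 1 1)
  => [a00 b00] [a01 b01] [a10 b10] [a11 b11] /=.
all: case=> h00; case=> h11; case=> h01 h01'.
all: complex_eq; lra.
Qed.

(** The projections are [(1 + N) / 2] and [(1 - N) / 2] with [N = pauli_along n] and [N^2 = 1].
    Hence the sum is [(U + N U N) / 2], and anticommutation gives [N U N = 2 (n . u) N - U]. *)
Lemma projective_measurement_pauli (P : 'I_2 -> 'M[R[i]]_2) :
  projective_measurement P ->
  exists2 n, dot n n = 1 &
    forall u, \sum_i P i *m pauli_along u *m P i
              = (dot n u)%:C *: pauli_along n.
Proof.
case=> hP; rewrite sum2E => hP1.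
have [h0 i0 r0] := hP 0.
(* A rank-one projection satisfies [P = P^2 = (tr P) P] and is nonzero. *)
have trP0 : \tr (P 0) = 1.
  have P0_neq0 : P 0 != 0 by rewrite -mxrank_eq0 r0.
  move: (rank1_mulmx_sqr r0); rewrite i0 -{1}[P 0]scale1r => /eqP.
  rewrite -subr_eq0 -scalerBl scaler_eq0 (negPf P0_neq0) orbF subr_eq0.
  by move/eqP.
have [n] := hermitian2_pauli h0; rewrite trP0 => P0E.
have two_neq0 : 2 != 0 :> R[i] by rewrite pnatr_eq0.
have P1E : P 1 = 2^-1 *: (1%:M - pauli_along n).
  have -> : P 1 = 1%:M - P 0 by rewrite -hP1 addrAC subrr add0r.
  apply: (scalerI two_neq0); rewrite scalerBr P0E !scalerA divff // !scale1r.
  by rewrite scaler_nat mulr2n opprD addrACA subrr add0r.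
have sqr_n : pauli_along n *m pauli_along n = 1%:M.
  move: i0; rewrite P0E -scalemxAl -scalemxAr.
  move/(scalerI (invr_neq0 two_neq0))/(congr1 ( *:%R 2)).
  rewrite !scalerA divff // !scale1r mulmxDl !mulmxDr !mul1mx mulmx1.
  rewrite scaler_nat mulr2n -addrA addrA => /addrI.
  by rewrite addrC => /addIr.
exists n.
  have := mxtrace_pauliM n n; rewrite sqr_n mxtrace1.
  by move/(congr1 (@complex.Re R)) => /=; lra.
move=> u; rewrite sum2E P0E P1E.
move: (pauli_along n) (pauli_along u) sqr_n (pauli_along_anticomm n u).
move=> N U NN NU.
have NUN : N *m U *m N = (2 * dot n u)%:C *: N - U.
  rewrite -mul_scalar_mx -NU mulmxDl -mulmxA -[U *m N *m N]mulmxA NN mulmx1.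
  by rewrite addrK mulmxA.
rewrite -!scalemxAl -!scalemxAr -!scalerDr !scalerA.
rewrite !mulmxDl !mulmxDr !mul1mx !mulmx1 !mulNmx !mulmxN opprK NUN.
move: (U *m N) (N *m U) => X Y; rewrite rmorphM rmorph_nat.
by apply/matrixP => i j; rewrite !mxE; field.
Qed.

(** The measurement of [sigma3], at which the discord will be attained. *)
Definition meas_z (i : 'I_2) : 'M[R[i]]_2 := delta_mx i i.

Lemma projective_measurement_z : projective_measurement meas_z.
Proof.
split=> [i|]; last first.
  rewrite [1%:M]scalar_mx_sum_delta.
  by apply: eq_bigr => i _; rewrite scale1r.
by rewrite /meas_z trmx_delta map_delta_mx mul_delta_mx mxrank_delta.
Qed.

Lemma dot_delta i v : dot (delta_mx 0 i) v = v 0 i.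
Proof.
rewrite /dot (bigD1 i) //= big1 ?addr0 => [|j /negPf ji].
  by rewrite !mxE !eqxx mul1r.
by rewrite mxE ji andbF mul0r.
Qed.

(** * Correlations and discord values in terms of the Bloch data *)

Lemma correlation_bloch x3 y3 (T : 'M[R]_3) a b :
  correlation (bloch_form x3 y3 T) a b
  = \sum_i \sum_j a 0 i * T i j * b 0 j.
Proof.
rewrite /correlation /bloch_form.
have -> : (4^-1 : R[i]) = (4^-1)%:C by rewrite fmorphV rmorph_nat.
rewrite -scalemxAl mxtraceZ !mulmxDl !mxtraceD -!scalemxAl !mxtraceZ.
(* Pauli matrices are traceless, so only the [T] terms survive. *)
rewrite !tensmx_mul !mxtrace_tens !mul1mx !mxtrace_pauli.
rewrite !mulr0 !mul0r !mulr0 !add0r.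
rewrite mulmx_suml raddf_sum /=.
rewrite (eq_bigr (fun i => (\sum_j 4 * (a 0 i * T i j * b 0 j))%:C)) => [|i _].
  rewrite -rmorph_sum -rmorphM /= mulr_sumr; apply: eq_bigr => i _.
  by rewrite -mulr_sumr mulKf ?pnatr_eq0.
rewrite mulmx_suml rmorph_sum /= raddf_sum; apply: eq_bigr => j _ /=.
rewrite -scalemxAl tensmx_mul mxtraceZ mxtrace_tens.
rewrite -!pauli_delta !mxtrace_pauliM -!rmorphM /= !dot_delta.
by congr (_%:C); ring.
Qed.

Lemma adjointZ m (a : R) (M : 'M[R[i]]_m) : (a%:C *: M) ^t* = a%:C *: M ^t*.
Proof.
by apply/matrixP => i j; rewrite !mxE rmorphM; congr (_ * _); apply: conjc_real.
Qed.

(** Products of Pauli matrices, the identity included, are orthogonal for the Hilbert-Schmidt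
    product and have squared norm 4; with the prefactor this leaves [4 / 16]. The difference between
    a state and its post-measurement state takes this shape. *)
Lemma normsq_pauli_tens u (w : 'I_3 -> 'rV[R]_3) :
  normsq (4^-1 *: (pauli_along u *t 1%:M
                   + \sum_j pauli_along (w j) *t pauli R j))
  = (dot u u + \sum_j dot (w j) (w j)) / 4.
Proof.
set X := _ *: _.
have hX : X ^t* = X.
  rewrite /X; have -> : (4^-1 : R[i]) = (4^-1)%:C by rewrite fmorphV rmorph_nat.
  rewrite adjointZ linearD /= map_mxD.
  rewrite trmx_tens map_mxT trmx1 map_mx1 pauli_along_herm.
  rewrite linear_sum /= raddf_sum.
  congr (_ *: (_ + _)); apply: eq_bigr => j _ /=.
  by rewrite trmx_tens map_mxT -pauli_delta !pauli_along_herm.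
rewrite /normsq hX /X -scalemxAl -scalemxAr scalerA mxtraceZ.
rewrite mulmxDl !mulmxDr !mxtraceD tensmx_mul mxtrace_tens mxtrace_pauliM.
rewrite mul1mx mxtrace1.
rewrite mulmx_suml mulmx_sumr !raddf_sum /=.
rewrite big1 => [|j _]; last first.
  by rewrite tensmx_mul mxtrace_tens mul1mx -pauli_delta mxtrace_pauli mulr0.
rewrite [X in _ + (X + _)]big1 => [|j _]; last first.
  by rewrite tensmx_mul mxtrace_tens mulmx1 -pauli_delta mxtrace_pauli mulr0.
rewrite (eq_bigr (fun j => (4 * dot (w j) (w j))%:C)) => [|j _].
  rewrite -rmorph_sum -mulr_sumr addr0 add0r.
  have -> : (4^-1 * 4^-1 : R[i]) = (16^-1)%:C.
    by rewrite -invfM -natrM fmorphV rmorph_nat.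
  have -> : (2%:R : R[i]) = 2%:C by rewrite rmorph_nat.
  by rewrite -rmorphM -rmorphD -rmorphM /=; field.
rewrite mulmx_suml raddf_sum (bigD1 j) //= big1 ?addr0 => [|k kj].
  rewrite tensmx_mul mxtrace_tens -!pauli_delta !mxtrace_pauliM -rmorphM /=.
  by rewrite dot_delta mxE !eqxx mulr1; congr (_%:C); ring.
rewrite tensmx_mul mxtrace_tens -!pauli_delta !mxtrace_pauliM -rmorphM /=.
by rewrite !dot_delta mxE (negPf kj) andbF !mulr0.
Qed.

Lemma post_measurement_tens P A B :
  post_measurement P (A *t B) = (\sum_i P i *m A *m P i) *t B.
Proof.
rewrite /post_measurement tensmx_suml; apply: eq_bigr => i _.
by rewrite !tensmx_mul mul1mx mulmx1.
Qed.

(** Grouping by the second factor suits a measurement that acts on the first qubit only. *)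
Lemma pauli_tensE (T : 'M[R]_3) :
  \sum_i \sum_j (T i j)%:C *: (pauli R i *t pauli R j)
  = \sum_j pauli_along (col j T)^T *t pauli R j.
Proof.
rewrite exchange_big; apply: eq_bigr => j _ /=.
rewrite tensmx_suml; apply: eq_bigr => i _.
by rewrite tensmxZl !mxE.
Qed.

(** The map [f M = M - post_measurement P M] is linear, kills [1 *t B], and projects each Bloch
    vector of the first qubit onto the plane orthogonal to [n]. Orthogonality of the Pauli products
    and Pythagoras then give the norm. *)
Lemma discord_valueE P x3 y3 (T : 'M[R]_3) (n : 'rV[R]_3) :
  (forall i, P i *m P i = P i) -> \sum_i P i = 1%:M ->
  dot n n = 1 ->
  (forall u,
     \sum_i P i *m pauli_along u *m P i = (dot n u)%:C *: pauli_along n) ->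
  normsq (bloch_form x3 y3 T - post_measurement P (bloch_form x3 y3 T))
  = (x3 ^+ 2 * (1 - n 0 2%R ^+ 2)
     + \sum_j (dot (col j T)^T (col j T)^T - dot n (col j T)^T ^+ 2)) / 4.
Proof.
move=> PP P1 nn hP.
pose perp u := u - dot n u *: n.
have perpE u : dot (perp u) (perp u) = dot u u - dot n u ^+ 2.
  (* The factor [2 - dot n n] equals 1 and turns the claim into a polynomial identity. *)
  transitivity (dot u u - (2 - dot n n) * dot n u ^+ 2); last first.
    by rewrite nn; ring.
  by rewrite /dot !sum3E !mxE /dot !sum3E; ring.
pose f M := M - post_measurement P M.
have fD M N : f (M + N) = f M + f N.
  rewrite /f addrACA -opprD; congr (_ - _).
  rewrite /post_measurement -big_split; apply: eq_bigr => i _ /=.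
  by rewrite mulmxDr mulmxDl.
have fZ a M : f (a *: M) = a *: f M.
  rewrite /f scalerBr; congr (_ - _).
  rewrite /post_measurement scaler_sumr; apply: eq_bigr => i _ /=.
  by rewrite -scalemxAr -scalemxAl.
have f1 B : f (1%:M *t B) = 0.
  rewrite /f post_measurement_tens.
  suff -> : \sum_i P i *m 1%:M *m P i = 1%:M by rewrite subrr.
  by rewrite -[RHS]P1; apply: eq_bigr => i _; rewrite mulmx1 PP.
have fP u B : f (pauli_along u *t B) = pauli_along (perp u) *t B.
  have -> : perp u = 1 *: u + (- dot n u) *: n by rewrite scale1r scaleNr.
  rewrite pauli_along_lincomb scale1r tensmxDl; congr (_ + _).
  by rewrite post_measurement_tens hP !tensmxZl rmorphN scaleNr.
have f_sum (M : 'I_3 -> 'M_(2 * 2)) : f (\sum_j M j) = \sum_j f (M j).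
  by rewrite !sum3E !fD.
rewrite /bloch_form pauli_tensE -/(f _) fZ !fD !fZ !f1 f_sum.
rewrite -[sigma3 R]/(pauli R 2%R) -pauli_delta fP -tensmxZl scaler0 add0r addr0.
set e3 := delta_mx 0 2%R.
have -> : x3%:C *: pauli_along (perp e3) = pauli_along (x3 *: perp e3).
  by have := pauli_along_lincomb x3 0 (perp e3) 0; rewrite !scale0r !addr0.
under eq_bigr do rewrite fP.
rewrite normsq_pauli_tens; congr ((_ + _) / _); last first.
  by apply: eq_bigr => j _; rewrite perpE.
transitivity (x3 ^+ 2 * dot (perp e3) (perp e3)).
  by rewrite /dot !sum3E !mxE /dot !sum3E; ring.
by rewrite perpE /e3 dot_delta !mxE /dot sum3E !mxE /=; ring.
Qed.

(** * Optimisation over settings and measurements *)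

Lemma dotC u v : dot u v = dot v u.
Proof. by apply: eq_bigr => i _; rewrite mulrC. Qed.

(** Cauchy-Schwarz: the component of [u] orthogonal to [v] has squared length [s^2 - t^2], which is
    nonnegative. *)
Lemma dot_le (s : R) u v :
  0 <= s -> dot u u = s ^+ 2 -> dot v v = 1 -> dot u v <= s.
Proof.
move=> s0 hu hv; set t := dot u v.
have : 0 <= dot (u - t *: v) (u - t *: v).
  by apply: sumr_ge0 => i _; rewrite -expr2 sqr_ge0.
suff -> : dot (u - t *: v) (u - t *: v) = s ^+ 2 - t ^+ 2.
  rewrite subr_ge0 -[t ^+ 2]real_normK ?num_real // ler_sqr ?nnegrE //.
  exact/le_trans/ler_norm.
transitivity (dot u u - 2 * t * dot u v + t ^+ 2 * dot v v).
  by rewrite /dot !sum3E !mxE; ring.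
by rewrite hu hv -/t; ring.
Qed.

Lemma dot_attained (s : R) u : 0 <= s -> dot u u = s ^+ 2 ->
  exists2 v, dot v v = 1 & dot u v = s.
Proof.
move=> s0 hu; have [s_eq0|sN0] := eqVneq s 0; last first.
  exists (s^-1 *: u); move: hu; rewrite /dot !sum3E !mxE => hu.
    apply: (mulfI (_ : s ^+ 2 != 0)); rewrite ?expf_eq0 // mulr1 -[RHS]hu.
    by field.
  by apply: (mulfI sN0); rewrite -expr2 -[RHS]hu; field.
(* For [s = 0] the vector [u] vanishes, so any unit vector serves. *)
exists (delta_mx 0 0); first by rewrite dot_delta mxE.
move: hu; rewrite s_eq0 expr0n /= => /eqP; rewrite /dot.
rewrite psumr_eq0 => [/allP /(_ 0)|i _]; last by rewrite -expr2 sqr_ge0.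
rewrite mem_index_enum -expr2 sqrf_eq0 => /(_ isT)/eqP u0.
by rewrite -/(dot _ _) dotC dot_delta.
Qed.

(** Pure and Werner states both meet these hypotheses. The inequality is what makes the third axis
    an optimal measurement direction. *)
Lemma error_rate_discord rho x3 y3 (T : 'M[R]_3) (s : R) :
  rho = bloch_form x3 y3 T ->
  0 <= s ->
  [/\ dot (row 0 T) (row 0 T) = s ^+ 2, dot (row 1 T) (row 1 T) = s ^+ 2
    & s ^+ 2 <= dot (row 2%R T) (row 2%R T) + x3 ^+ 2] ->
  [/\ dot (row 0 T) (row 1 T) = 0, dot (row 0 T) (row 2%R T) = 0
    & dot (row 1 T) (row 2%R T) = 0] ->
  [/\ error_rates rho (min_error_rate rho),
      discord_values rho (geometric_discord rho)
    & min_error_rate rho = 1 / 2 * (1 - Num.sqrt (2 * geometric_discord rho))].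
Proof.
move=> rhoE s0 [h00 h11 h22] [h01 h02 h12].
have rateE b b' :
    error_rate rho b b' = 1 / 2 - (dot (row 0 T) b + dot (row 1 T) b') / 4.
  rewrite /error_rate /outcomes_differ rhoE !correlation_bloch /dot.
  by rewrite !sum3E !mxE /=; field.
have Emin : error_rates rho ((1 - s) / 2).
  have [b hb tb] := dot_attained s0 h00.
  have [b' hb' tb'] := dot_attained s0 h11.
  by exists b => //; exists b' => //; rewrite rateE tb tb'; field.
have Elb : lbound (error_rates rho) ((1 - s) / 2).
  move=> _ [b hb [b' hb' <-]]; rewrite rateE.
  by have := dot_le s0 h00 hb; have := dot_le s0 h11 hb'; lra.
pose k := dot (row 2%R T) (row 2%R T) + x3 ^+ 2.
(* The action of [P] on Bloch vectors is kept beside the value, since it is what later identifies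
   [n] for [meas_z]. *)
have discE P : projective_measurement P ->
    exists2 n, dot n n = 1 &
      (forall u,
         \sum_i P i *m pauli_along u *m P i = (dot n u)%:C *: pauli_along n) /\
      normsq (rho - post_measurement P rho)
      = (2 * s ^+ 2 + (k - s ^+ 2) * (1 - n 0 2%R ^+ 2)) / 4.
  move=> hP; have [n nn pinch] := projective_measurement_pauli hP.
  exists n => //; split=> //; have [idP sumP] := hP.
  rewrite rhoE (discord_valueE _ _ _ _ _ nn pinch) //; last first.
    by move=> i; case: (idP i).
  congr (_ / 4).
  (* This is [tr K - n^T K n], expanded in the inner products of the rows of [T]. *)
  transitivity (k * (1 - n 0 2%R ^+ 2)
      + dot (row 0 T) (row 0 T) * (1 - n 0 0 ^+ 2)
      + dot (row 1 T) (row 1 T) * (1 - n 0 1 ^+ 2)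
      - 2 * (n 0 0 * n 0 1 * dot (row 0 T) (row 1 T)
             + n 0 0 * n 0 2%R * dot (row 0 T) (row 2%R T)
             + n 0 1 * n 0 2%R * dot (row 1 T) (row 2%R T))).
    by rewrite /k /dot !sum3E !mxE; ring.
  rewrite h00 h01 h02 h12 h11.
  have -> : n 0 1 ^+ 2 = 1 - n 0 0 ^+ 2 - n 0 2%R ^+ 2.
    by rewrite -nn /dot sum3E; ring.
  by ring.
have Dlb : lbound (discord_values rho) (s ^+ 2 / 2).
  move=> _ [P /discE [n nn [_ ->]] <-].
  have n_le1 : n 0 2%R ^+ 2 <= 1 by move: nn; rewrite /dot sum3E; nra.
  by move: h22; rewrite -/k; nra.
have Dmin : discord_values rho (s ^+ 2 / 2).
  exists meas_z; first exact: projective_measurement_z.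
  have [n nn [pinch ->]] := discE _ projective_measurement_z.
  (* Measuring [sigma3] leaves [sigma3] unchanged; the upper-left entry of this identity reads
     [n_3^2 = 1]. *)
  have nz : n 0 2%R ^+ 2 = 1.
    have [n00 _ _ _] := pauli_alongE n.
    have [e00 _ _ _] := pauli_alongE (delta_mx 0 2%R).
    have := congr1 (fun M : 'M_2 => M 0 0) (pinch (delta_mx 0 2%R)).
    rewrite mxE n00 dotC dot_delta !sum2E !mxE !sum2E !mxE !sum2E !mxE.
    rewrite e00 !mxE /=.
    rewrite !(mul0r, mulr0, mul1r, mulr1, addr0, add0r).
    by rewrite -rmorphM => /complexI E; rewrite expr2 -E.
  by rewrite nz; field.
rewrite /min_error_rate /geometric_discord.
rewrite (inf_min Emin Elb) (inf_min Dmin Dlb).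
split=> //; have -> : 2 * (s ^+ 2 / 2) = s ^+ 2 by field.
by rewrite sqrtr_sqr ger0_norm //; field.
Qed.

(** * Matrix entries of a Bloch form, and idempotent states *)

Lemma bloch_entry x3 y3 (T : 'M[R]_3) (i k j l : 'I_2) :
  4 * bloch_form x3 y3 T (mxtens_index (i, k)) (mxtens_index (j, l)) =
  (1%:M : 'M[R[i]]_2) i j * (1%:M + y3%:C *: sigma3 R) k l
  + x3%:C * sigma3 R i j * (1%:M : 'M[R[i]]_2) k l
  + \sum_m pauli_along (col m T)^T i j * pauli R m k l.
Proof.
rewrite /bloch_form pauli_tensE mxE mulrA mulfV ?pnatr_eq0 // mul1r.
rewrite !(mxE, summxE) !mxtens_indexK /=.
congr (_ + _); first by ring.
by apply: eq_bigr => m _; rewrite tensmxE.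
Qed.

(** Turns matrix equations on states into real equations in [x3], [y3] and [T]. In [e i k j l] the
    row is [(i, k)] and the column [(j, l)], with [i] and [j] on the first qubit; the factor 4
    clears the prefactor. *)
Lemma bloch_entries x3 y3 (T : 'M[R]_3) :
  let e (i k j l : 'I_2) :=
    4 * bloch_form x3 y3 T (mxtens_index (i, k)) (mxtens_index (j, l)) in
  [/\ [/\ e 0 0 0 0 = (1 + x3 + y3 + T 2%R 2%R)%:C,
          e 0 0 0 1 = T 2%R 0 -i* T 2%R 1,
          e 0 0 1 0 = T 0 2%R -i* T 1 2%R &
          e 0 0 1 1 = (T 0 0 - T 1 1) -i* (T 0 1 + T 1 0)],
      [/\ e 0 1 0 0 = T 2%R 0 +i* T 2%R 1,
          e 0 1 0 1 = (1 + x3 - y3 - T 2%R 2%R)%:C,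
          e 0 1 1 0 = (T 0 0 + T 1 1) +i* (T 0 1 - T 1 0) &
          e 0 1 1 1 = (- T 0 2%R) +i* T 1 2%R],
      [/\ e 1 0 0 0 = T 0 2%R +i* T 1 2%R,
          e 1 0 0 1 = (T 0 0 + T 1 1) -i* (T 0 1 - T 1 0),
          e 1 0 1 0 = (1 - x3 + y3 - T 2%R 2%R)%:C &
          e 1 0 1 1 = (- T 2%R 0) +i* T 2%R 1] &
      [/\ e 1 1 0 0 = (T 0 0 - T 1 1) +i* (T 0 1 + T 1 0),
          e 1 1 0 1 = (- T 0 2%R) -i* T 1 2%R,
          e 1 1 1 0 = (- T 2%R 0) -i* T 2%R 1 &
          e 1 1 1 1 = (1 - x3 - y3 + T 2%R 2%R)%:C]].
Proof.
rewrite /=.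
have tE m : let t := pauli_along (col m T)^T in
    [/\ t 0 0 = (T 2%R m)%:C, t 0 1 = T 0 m -i* T 1 m,
        t 1 0 = T 0 m +i* T 1 m & t 1 1 = (- T 2%R m)%:C].
  by have := pauli_alongE (col m T)^T; rewrite !mxE.
have pE m := pauli_alongE (delta_mx 0 m : 'rV[R]_3).
have [t000 t001 t010 t011] := tE 0.
have [t100 t101 t110 t111] := tE 1.
have [t200 t201 t210 t211] := tE 2%R.
have [p000 p001 p010 p011] := pE 0.
have [p100 p101 p110 p111] := pE 1.
have [p200 p201 p210 p211] := pE 2%R.
do 2!split; rewrite bloch_entry -[sigma3 R]/(pauli R 2%R);
  rewrite -!pauli_delta sum3E -!pauli_delta !mxE.
all: rewrite ?t000 ?t001 ?t010 ?t011 ?t100 ?t101 ?t110 ?t111.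
all: rewrite ?t200 ?t201 ?t210 ?t211 ?p000 ?p001 ?p010 ?p011.
all: rewrite ?p100 ?p101 ?p110 ?p111 ?p200 ?p201 ?p210 ?p211 !mxE /=.
all: complex_eq; ring.
Qed.

(* The Pauli coefficients of [rho *m rho = rho]: [x = T y] and
   [T + cof T = x y^T], with [x = x3 e_3] and [y = y3 e_3]. *)
Lemma idempotent_bloch_relations x3 y3 (T : 'M[R]_3) :
  bloch_form x3 y3 T *m bloch_form x3 y3 T = bloch_form x3 y3 T ->
  [/\ T 0 2%R * y3 = 0, T 1 2%R * y3 = 0 & T 2%R 2%R * y3 = x3] /\
  [/\ [/\ T 0 0 = T 1 2%R * T 2%R 1 - T 1 1 * T 2%R 2%R,
          T 0 1 = T 1 0 * T 2%R 2%R - T 1 2%R * T 2%R 0 &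
          T 0 2%R = T 1 1 * T 2%R 0 - T 1 0 * T 2%R 1],
      [/\ T 1 0 = T 0 1 * T 2%R 2%R - T 0 2%R * T 2%R 1,
          T 1 1 = T 0 2%R * T 2%R 0 - T 0 0 * T 2%R 2%R &
          T 1 2%R = T 0 0 * T 2%R 1 - T 0 1 * T 2%R 0] &
      [/\ T 2%R 0 = T 0 2%R * T 1 1 - T 0 1 * T 1 2%R,
          T 2%R 1 = T 0 0 * T 1 2%R - T 0 2%R * T 1 0 &
          T 2%R 2%R = x3 * y3 - (T 0 0 * T 1 1 - T 0 1 * T 1 0)]].
Proof.
move=> idem; pose e (i k j l : 'I_2) :=
  4 * bloch_form x3 y3 T (mxtens_index (i, k)) (mxtens_index (j, l)).
have {idem} E i k j l :
    e i k 0 0 * e 0 0 j l + e i k 0 1 * e 0 1 j l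
    + (e i k 1 0 * e 1 0 j l + e i k 1 1 * e 1 1 j l) = 4 * e i k j l.
  pose at_ikjl (M : 'M[R[i]]_(2 * 2)) :=
    M (mxtens_index (i, k)) (mxtens_index (j, l)).
  have := congr1 at_ikjl idem; rewrite /at_ikjl mxE mxtens_sum !sum2E => idemE.
  by rewrite /e -[in RHS]idemE; ring.
have := bloch_entries x3 y3 T; rewrite /= -!/(e _ _ _ _).
move: (T 0 0) (T 0 1) (T 0 2%R) (T 1 0) (T 1 1) (T 1 2%R).
move: (T 2%R 0) (T 2%R 1) (T 2%R 2%R).
move=> t20 t21 t22 t00 t01 t02 t10 t11 t12.
case=> -[e0000 e0001 e0010 e0011] [e0100 e0101 e0110 e0111].
move=> [e1000 e1001 e1010 e1011] [e1100 e1101 e1110 e1111].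
have four (a b : R) : 4 * (a +i* b) = (4 * a) +i* (4 * b).
  by complex_eq; ring.
have Er i k j l := congr1 (@complex.Re R) (E i k j l).
have Ei i k j l := congr1 (@complex.Im R) (E i k j l).
(* Sixteen real equations: the diagonal, then real and imaginary parts of the six entries above it.
   The relations are linear combinations of these, with quadratic monomials as atoms. *)
move: (Er 0 0 0 0) (Er 0 1 0 1) (Er 1 0 1 0) (Er 1 1 1 1).
move: (Er 0 0 0 1) (Ei 0 0 0 1) (Er 0 0 1 0) (Ei 0 0 1 0).
move: (Er 0 0 1 1) (Ei 0 0 1 1) (Er 0 1 1 0) (Ei 0 1 1 0).
move: (Er 0 1 1 1) (Ei 0 1 1 1) (Er 1 0 1 1) (Ei 1 0 1 1).
rewrite ?(e0000, e0001, e0010, e0011, e0100, e0101, e0110, e0111).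
rewrite ?(e1000, e1001, e1010, e1011, e1100, e1101, e1110, e1111) !four /=.
clear; move=> ? ? ? ? ? ? ? ? ? ? ? ? ? ? ? ?.
by split; split; (try split); lra.
Qed.

(* Multiplying [T + cof T = x y^T] by [T^T] on the right and using [x = T y]
   gives [T T^T = x x^T - det T]. *)
Lemma idempotent_bloch_rows x3 y3 (T : 'M[R]_3) :
  bloch_form x3 y3 T *m bloch_form x3 y3 T = bloch_form x3 y3 T ->
  exists d, forall i j, dot (row i T) (row j T) =
     (x3 *+ (i == 2%R)) * (x3 *+ (j == 2%R)) + d *+ (i == j).
Proof.
case/idempotent_bloch_relations => -[y0 y1 y2].
move=> [[t00 t01 t02] [t10 t11 t12] [t20 t21 t22]].
(* The witness is [- det T], expanded along the first row. *)
exists (- (T 0 0 * (T 1 1 * T 2%R 2%R - T 1 2%R * T 2%R 1)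
           - T 0 1 * (T 1 0 * T 2%R 2%R - T 1 2%R * T 2%R 0)
           + T 0 2%R * (T 1 0 * T 2%R 1 - T 1 1 * T 2%R 0))).
move=> + j.
apply: ord3_ind; rewrite /dot sum3E !mxE.
(* Row [i] is replaced by minus its cofactors; pairing these with row [j] gives [- det T] if [i = j]
   and 0 otherwise. *)
- transitivity ((T 1 2%R * T 2%R 1 - T 1 1 * T 2%R 2%R) * T j 0
      + (T 1 0 * T 2%R 2%R - T 1 2%R * T 2%R 0) * T j 1
      + (T 1 1 * T 2%R 0 - T 1 0 * T 2%R 1) * T j 2%R).
    by rewrite -t00 -t01 -t02.
  by move: j; apply: ord3_ind => /=; ring.
- transitivity ((T 0 1 * T 2%R 2%R - T 0 2%R * T 2%R 1) * T j 0
      + (T 0 2%R * T 2%R 0 - T 0 0 * T 2%R 2%R) * T j 1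
      + (T 0 0 * T 2%R 1 - T 0 1 * T 2%R 0) * T j 2%R).
    by rewrite -t10 -t11 -t12.
  by move: j; apply: ord3_ind => /=; ring.
transitivity ((T 0 2%R * T 1 1 - T 0 1 * T 1 2%R) * T j 0
    + (T 0 0 * T 1 2%R - T 0 2%R * T 1 0) * T j 1
    + (x3 * y3 - (T 0 0 * T 1 1 - T 0 1 * T 1 0)) * T j 2%R).
  by rewrite -t20 -t21 -t22.
(* The last row also carries the entry [x3 * y3] of [x y^T], and [x = T y] evaluates its
   contribution. *)
have <- : y3 * T j 2%R = x3 *+ (j == 2%R).
  by rewrite mulrC; move: j; apply: ord3_ind.
by move: j; apply: ord3_ind => /=; ring.
Qed.

(** * Werner states *)

Lemma tens_ketE (a b i k : 'I_2) :
  (((delta_mx a 0 : 'cV[R[i]]_2) *t (delta_mx b 0 : 'cV[R[i]]_2))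
     : 'cV[R[i]]_(2 * 2)) (mxtens_index (i, k)) 0
  = ((i == a) && (k == b))%:R%:C.
Proof.
by rewrite mxE mxtens_indexK !mxE !ord1 !eqxx !andbT -natrM mulnb rmorph_nat.
Qed.

Lemma projE m (v : 'cV[R[i]]_m) i j : proj v i j = v i 0 * (v j 0)^*%C.
Proof. by rewrite mxE big_ord1 !mxE. Qed.

(** [phi s] and [psi s] are the coordinates of the Bell vectors with relative sign [s], without
    their normalisation; its square, one half, yields the weights [F / 2] and [(1 - F) / 6]. *)
Lemma werner_entry F (i k j l : 'I_2) :
  let phi s (i k : 'I_2) : R :=
    ((i == 0) && (k == 0))%:R + s * ((i == 1) && (k == 1))%:R in
  let psi s (i k : 'I_2) : R :=
    ((i == 0) && (k == 1))%:R + s * ((i == 1) && (k == 0))%:R in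
  werner F (mxtens_index (i, k)) (mxtens_index (j, l))
  = (F * (phi 1 i k * phi 1 j l) / 2
     + (1 - F) / 6 * (phi (-1) i k * phi (-1) j l + psi 1 i k * psi 1 j l
                      + psi (-1) i k * psi (-1) j l))%:C.
Proof.
move=> phi psi.
have c2 : (Num.sqrt 2)^-1 * (Num.sqrt 2)^-1 = 2^-1 :> R.
  by rewrite -invfM -expr2 sqr_sqrtr ?ler0n.
have projC (v : 'cV[R[i]]_(2 * 2)) (x y : R) p q :
    v p 0 = x%:C -> v q 0 = y%:C ->
    proj (((Num.sqrt 2)^-1)%:C *: v) p q = (x * y / 2)%:C.
  move=> vp vq; rewrite projE !mxE vp vq -!rmorphM conjc_real -rmorphM /=.
  by congr (_%:C); rewrite mulrACA c2 mulrC.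
have addE (v w : 'cV[R[i]]_(2 * 2)) p x y (s : R) :
    v p 0 = x%:C -> w p 0 = y%:C ->
    (v + s%:C *: w) p 0 = (x + s * y)%:C.
  by move=> vp wp; rewrite !mxE vp wp rmorphD rmorphM.
pose uu : 'cV[R[i]]_(2 * 2) := ket_up R *t ket_up R.
pose ud : 'cV[R[i]]_(2 * 2) := ket_up R *t ket_down R.
pose du : 'cV[R[i]]_(2 * 2) := ket_down R *t ket_up R.
pose dd : 'cV[R[i]]_(2 * 2) := ket_down R *t ket_down R.
have PP s p q p' q' :
    proj (((Num.sqrt 2)^-1)%:C *: (uu + s%:C *: dd))
      (mxtens_index (p, q)) (mxtens_index (p', q'))
    = (phi s p q * phi s p' q' / 2)%:C.
  by apply: projC; apply: addE; apply: tens_ketE.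
have QQ s p q p' q' :
    proj (((Num.sqrt 2)^-1)%:C *: (ud + s%:C *: du))
      (mxtens_index (p, q)) (mxtens_index (p', q'))
    = (psi s p q * psi s p' q' / 2)%:C.
  by apply: projC; apply: addE; apply: tens_ketE.
have -> : werner F = F%:C *: proj (((Num.sqrt 2)^-1)%:C *: (uu + 1%:C *: dd))
  + ((1 - F) / 3)%:C *: (proj (((Num.sqrt 2)^-1)%:C *: (uu + (-1)%:C *: dd))
     + proj (((Num.sqrt 2)^-1)%:C *: (ud + 1%:C *: du))
     + proj (((Num.sqrt 2)^-1)%:C *: (ud + (-1)%:C *: du))).
  by rewrite !rmorphN !rmorph1 !scaleN1r !scale1r.
have mixE (a b x1 x2 x3 x4 : R) (M1 M2 M3 M4 : 'M[R[i]]_(2 * 2)) p q :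
    M1 p q = x1%:C -> M2 p q = x2%:C -> M3 p q = x3%:C -> M4 p q = x4%:C ->
    (a%:C *: M1 + b%:C *: (M2 + M3 + M4)) p q
    = (a * x1 + b * (x2 + x3 + x4))%:C.
  by move=> e1 e2 e3 e4; rewrite !mxE e1 e2 e3 e4 !rmorphD !rmorphM !rmorphD.
rewrite (mixE _ _ _ _ _ _ _ _ _ _ _ _ (PP 1 i k j l) (PP (-1) i k j l)
  (QQ 1 i k j l) (QQ (-1) i k j l)).
by congr (_%:C); field.
Qed.

Lemma werner_rows x3 y3 (T : 'M[R]_3) F :
  bloch_form x3 y3 T = werner F ->
  x3 = 0
  /\ forall i j,
       dot (row i T) (row j T) = ((4 * F - 1) / 3) ^+ 2 *+ (i == j).
Proof.
move=> bw; have four (a : R) : 4 * a%:C = (4 * a)%:C.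
  by rewrite rmorphM rmorph_nat.
have := bloch_entries x3 y3 T; rewrite /= bw !werner_entry !four /=.
(* The first row, the diagonal and the entry [e 0 1 1 0] determine [x3] and all of [T]. *)
case=> -[[e0000] [e0001 e0001'] [e0010 e0010'] [e0011 e0011']].
case=> _ [e0101] [e0110 e0110'] _ [_ _ [e1010] _] [_ _ _ [e1111]].
have x0 : x3 = 0 by lra.
have t00 : T 0 0 = (4 * F - 1) / 3 by lra.
have t11 : T 1 1 = - ((4 * F - 1) / 3) by lra.
have t22 : T 2%R 2%R = (4 * F - 1) / 3 by lra.
have t01 : T 0 1 = 0 by lra.
have t02 : T 0 2%R = 0 by lra.
have t10 : T 1 0 = 0 by lra.
have t12 : T 1 2%R = 0 by lra.
have t20 : T 2%R 0 = 0 by lra.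
have t21 : T 2%R 1 = 0 by lra.
split=> //; do 2!apply: ord3_ind; rewrite /dot sum3E !mxE.
all: rewrite ?t00 ?t01 ?t02 ?t10 ?t11 ?t12 ?t20 ?t21 ?t22 /=; ring.
Qed.

End Pauli.

Theorem lemma2 (R : realType) (rho : 'M[R[i]]_(2 * 2))
    (x3 y3 : R) (T : 'M[R]_3) :
  two_qubit_state rho ->
  rho = bloch_form x3 y3 T ->
  pure_state rho \/ (exists F : R, 0 <= F <= 1 /\ rho = werner F) ->
  [/\ error_rates rho (min_error_rate rho),
      discord_values rho (geometric_discord rho)
    & min_error_rate rho = 1 / 2 * (1 - Num.sqrt (2 * geometric_discord rho))].
Proof.
move=> _ rhoE [[[_ tr1] rk1]|[F [_ rhoW]]].
  have idem := rank1_mulmx_sqr rk1; rewrite tr1 scale1r rhoE in idem.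
  have [d dotE] := idempotent_bloch_rows idem.
  have d0 : 0 <= d.
    (* [d] is the squared length of the first row, so [s] can be taken as its square root. *)
    have := dotE 0 0; rewrite /= mulr0n mul0r add0r mulr1n => <-.
    by apply: sumr_ge0 => i _; rewrite -expr2 sqr_ge0.
  apply: (error_rate_discord rhoE (sqrtr_ge0 d));
    rewrite ?sqr_sqrtr // !dotE /=.
    split; rewrite ?mulr0n ?mul0r ?add0r ?mulr1n -?expr2 //.
    by have := sqr_ge0 x3; lra.
  by split; rewrite ?mulr0n ?mul0r ?add0r.
have [x0 dotE] := werner_rows (etrans (esym rhoE) rhoW).
(* The absolute value is needed because [(4 F - 1) / 3] is negative for [F < 1/4]. *)
apply: (error_rate_discord rhoE (normr_ge0 ((4 * F - 1) / 3))).
  by rewrite !dotE real_normK ?num_real // x0 expr0n addr0.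
by rewrite !dotE.
Qed.
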